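(* Let $p$ be a prime, let $n\ge 1$, and let $G$ be isomorphic to the Hanaki group $A(n,p)$. Let $\Gamma_G$ be the non-commuting graph of $G$. Then: (a) $E(\Gamma_G)=LE(\Gamma_G)=LE^+(\Gamma_G)$. (b) $\Gamma_G$ is not hypoenergetic, not hyperenergetic, not L-hyperenergetic and not Q-hyperenergetic.
   Context: The group $A(n,p)$ consists of the matrices $V(a,b,c)=\begin{bmatrix}1&0&0\\ a&1&0\\ b&c&1\end{bmatrix}$ with $a,b,c\in GF(p^n)$, under matrix multiplication, so $V(a,b,c)V(a',b',c')=V(a+a',\,b+b'+ca',\,c+c')$. For a finite non-abelian group $G$ with center $Z(G)$, the non-commuting graph $\Gamma_G$ is the simple undirected graph with vertex set $G\setminus Z(G)$ in which $x,y$ are adjacent iff $xy\ne yx$. For a finite simple graph $\mathcal G$ with vertex set $v(\mathcal G)$, edge set $e(\mathcal G)$, adjacency matrix $A(\mathcal G)$ and diagonal degree matrix $D(\mathcal G)$, put $L(\mathcal G)=D(\mathcal G)-A(\mathcal G)$ (Laplacian) and $Q(\mathcal G)=D(\mathcal G)+A(\mathcal G)$ (signless Laplacian). With sums over eigenvalues counted with multiplicity, define $E(\mathcal G)=\sum_{\lambda}|\lambda|$ ($\lambda$ eigenvalues of $A(\mathcal G)$), $LE(\mathcal G)=\sum_{\beta}\left|\beta-\frac{2|e(\mathcal G)|}{|v(\mathcal G)|}\right|$ ($\beta$ eigenvalues of $L(\mathcal G)$), $LE^+(\mathcal G)=\sum_{\gamma}\left|\gamma-\frac{2|e(\mathcal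 G)|}{|v(\mathcal G)|}\right|$ ($\gamma$ eigenvalues of $Q(\mathcal G)$). With $K_n$ the complete graph on $n$ vertices, $\mathcal G$ is called hyperenergetic if $E(\mathcal G)>E(K_{|v(\mathcal G)|})$, hypoenergetic if $E(\mathcal G)<|v(\mathcal G)|$, L-hyperenergetic if $LE(\mathcal G)>LE(K_{|v(\mathcal G)|})$, and Q-hyperenergetic if $LE^+(\mathcal G)>LE^+(K_{|v(\mathcal G)|})$. *)

(* Defs.v *)
From mathcomp Require Import all_boot all_order all_algebra all_fingroup.
From mathcomp Require Import all_solvable all_field.

Set Implicit Arguments.
Unset Strict Implicit.
Unset Printing Implicit Defensive.

Import Order.TTheory GRing.Theory Num.Theory.
Local Open Scope ring_scope.

Record sgraph := SGraph {
  vertex :> finType;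
  adj : rel vertex;
  adj_sym : symmetric adj;
  adj_irr : irreflexive adj }.

Definition edges (g : sgraph) : {set {set g}} :=
  [set [set u.1; u.2] | u : g * g & adj u.1 u.2].

Definition degree (g : sgraph) (x : g) : nat := #|[set y | adj x y]|.

Definition adjacency_mx (g : sgraph) : 'M[algC]_#|g| :=
  \matrix_(i, j) (adj (enum_val i) (enum_val j))%:R.

Definition degree_mx (g : sgraph) : 'M[algC]_#|g| :=
  diag_mx (\row_i (degree (enum_val i))%:R).

Definition laplacian_mx (g : sgraph) := degree_mx g - adjacency_mx g.

Definition signless_laplacian_mx (g : sgraph) := degree_mx g + adjacency_mx g.

(* The matrices above have integer entries, so all their complex eigenvalues  *)
(* lie in algC; they are listed here with algebraic multiplicity.             *)
Definition eigenvalues n (A : 'M[algC]_n) : seq algC :=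
  sval (closed_field_poly_normal (char_poly A)).

Lemma char_poly_eigenvalues n (A : 'M[algC]_n) :
  char_poly A = \prod_(z <- eigenvalues A) ('X - z%:P).
Proof.
rewrite /eigenvalues; case: closed_field_poly_normal => s /= {1}->.
by rewrite (monicP (char_poly_monic A)) scale1r.
Qed.

Definition avg_degree (g : sgraph) : algC := (2 * #|edges g|)%N%:R / #|g|%:R.

Definition energy (g : sgraph) : algC :=
  \sum_(z <- eigenvalues (adjacency_mx g)) `|z|.

Definition laplacian_energy (g : sgraph) : algC :=
  \sum_(z <- eigenvalues (laplacian_mx g)) `|z - avg_degree g|.

Definition signless_laplacian_energy (g : sgraph) : algC :=
  \sum_(z <- eigenvalues (signless_laplacian_mx g)) `|z - avg_degree g|.

(* The order of algC is only partial, but the three energies are real, so the *)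
(* comparisons below are between comparable numbers.                          *)
Lemma energy_real g : energy g \is Num.real.
Proof. by rewrite ger0_real ?sumr_ge0. Qed.

Lemma laplacian_energy_real g : laplacian_energy g \is Num.real.
Proof. by rewrite ger0_real ?sumr_ge0. Qed.

Lemma signless_laplacian_energy_real g :
  signless_laplacian_energy g \is Num.real.
Proof. by rewrite ger0_real ?sumr_ge0. Qed.

Lemma complete_adj_sym n : symmetric (fun i j : 'I_n => i != j).
Proof. by move=> i j; rewrite eq_sym. Qed.

Lemma complete_adj_irr n : irreflexive (fun i j : 'I_n => i != j).
Proof. by move=> i; rewrite eqxx. Qed.

Definition complete_graph (n : nat) : sgraph :=
  SGraph (@complete_adj_sym n) (@complete_adj_irr n).

Definition hyperenergetic (g : sgraph) : bool :=
  energy (complete_graph #|g|) < energy g.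

Definition hypoenergetic (g : sgraph) : bool := energy g < #|g|%:R.

Definition L_hyperenergetic (g : sgraph) : bool :=
  laplacian_energy (complete_graph #|g|) < laplacian_energy g.

Definition Q_hyperenergetic (g : sgraph) : bool :=
  signless_laplacian_energy (complete_graph #|g|)
    < signless_laplacian_energy g.

Section NonCommutingGraph.

Variables (gT : finGroupType) (G : {group gT}).

Definition noncentral : finType := {x : gT | x \in G :\: 'Z(G)%g}.

Definition noncommuting : rel noncentral :=
  fun x y => (val x * val y != val y * val x)%g.

Lemma noncommuting_sym : symmetric noncommuting.
Proof. by move=> x y; rewrite /noncommuting eq_sym. Qed.

Lemma noncommuting_irr : irreflexive noncommuting.
Proof. by move=> x; rewrite /noncommuting eqxx. Qed.

Definition noncommuting_graph : sgraph :=
  SGraph noncommuting_sym noncommuting_irr.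

End NonCommutingGraph.

Section HanakiGroup.

Variable F : finFieldType.

Definition hanaki_mx (a b c : F) : 'M[F]_3 :=
  \matrix_(i < 3, j < 3)
    nth 0 (nth [::] [:: [:: 1; 0; 0];
                        [:: a; 1; 0];
                        [:: b; c; 1]] i) j.

Lemma hanaki_mxM a b c a' b' c' :
  hanaki_mx a b c *m hanaki_mx a' b' c'
    = hanaki_mx (a + a') (b + b' + c * a') (c + c').
Proof.
apply/matrixP=> i j; rewrite !mxE !big_ord_recl big_ord0 !mxE /=.
case: i => [[|[|[|i]]] Hi] //; case: j => [[|[|[|j]]] Hj] //=;
  rewrite ?(mul0r, mulr0, mul1r, mulr1, add0r, addr0) //.
by rewrite addrCA addrC.
Qed.

Lemma hanaki_mx1 : hanaki_mx 0 0 0 = 1%:M.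
Proof.
apply/matrixP=> i j; rewrite !mxE.
by case: i => [[|[|[|i]]] Hi] //; case: j => [[|[|[|j]]] Hj].
Qed.

Definition hanaki_set : {set {'GL_3[F]}} :=
  [set g : {'GL_3[F]} |
    [exists a, exists b, exists c, val g == hanaki_mx a b c]].

Lemma hanaki_setP (g : {'GL_3[F]}) :
  reflect (exists a b c, val g = hanaki_mx a b c) (g \in hanaki_set).
Proof.
rewrite inE; apply: (iffP existsP).
  by case=> a /existsP[b /existsP[c /eqP]]; exists a, b, c.
case=> a [b [c eg]]; exists a; apply/existsP; exists b.
by apply/existsP; exists c; apply/eqP.
Qed.

Lemma hanaki_group_set : group_set hanaki_set.
Proof.
apply/group_setP; split.
  by apply/hanaki_setP; exists 0, 0, 0; rewrite hanaki_mx1.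
move=> g h /hanaki_setP[a [b [c eg]]] /hanaki_setP[a' [b' [c' eh]]].
apply/hanaki_setP; exists (a + a'), (b + b' + c * a'), (c + c').
by rewrite -hanaki_mxM -eg -eh.
Qed.

Canonical hanaki_group : {group {'GL_3[F]}} := Group hanaki_group_set.

(* Every matrix V(a,b,c) is invertible, so none is lost by working in GL_3.   *)
Lemma hanaki_mx_in a b c :
  exists2 g : {'GL_3[F]}, g \in hanaki_set & val g = hanaki_mx a b c.
Proof.
have u : hanaki_mx a b c \is a GRing.unit.
  apply/unitrP; exists (hanaki_mx (- a) (- b + c * a) (- c)).
  split; rewrite -[LHS]/(_ *m _) hanaki_mxM -[RHS]/(1%:M) -hanaki_mx1.
    by rewrite !addNr (addrAC (- b)) addNr add0r mulNr subrr.
  by rewrite !addrN addrA addrN add0r mulrN subrr.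
by exists (FinRing.unit _ u) => //; apply/hanaki_setP; exists a, b, c.
Qed.

End HanakiGroup.

(* Main.v *)
(* Commuting is transitive on the non-central elements of A(n,p) and all     *)
(* their centralizers have order q^2, q = p^n, so the non-commuting graph is *)
(* complete multipartite and d-regular.  A complete multipartite d-regular   *)
(* graph on N vertices satisfies A^2 + (N - d) A = d J, so A only has        *)
(* eigenvalues 0, d and d - N.  On these |w| is a quadratic polynomial in w, *)
(* and the traces of A and A^2 give E = 2d; by regularity LE and LE+ have    *)
(* the same value.  As K_N has energies 2(N - 1), it remains to see that     *)
(* d <= N - 1 and N <= 2d.                                                   *)

Require Import Defs.
From mathcomp Require Import all_boot all_order all_algebra all_fingroup.
From mathcomp Require Import all_solvable all_field.
From mathcomp Require Import ring zify.

Set Implicit Arguments.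
Unset Strict Implicit.
Unset Printing Implicit Defensive.

Import Order.TTheory GRing.Theory Num.Theory.
Local Open Scope ring_scope.

(** In [A(n,p)] commutation only depends on the pairs [(a, c)]: it is their proportionality. Hence
    non-central elements have abelian centralizers of common order [k] ([hanaki_cent1_abelian],
    [card_hanaki_cent1]), which makes non-adjacency transitive and every degree equal to
    [d = |G| - k]. Counting common neighbours gives the quadratic identity [adjacency_mx_sqr]. By
    regularity the three matrices are [A], [d - A] and [d + A], all of the form [c + e A] with
    [e ^+ 2 = 1], so [sum_norm_eigenvalues] yields the three energies at once. With
    [N = |G| - |Z(G)|], the final inequalities follow from [|Z(G)| < k] and [2 k <= |G|]. *)

(** * Power sums of eigenvalues as traces *)

Lemma char_poly_conj (R : comUnitRingType) n (P A : 'M[R]_n) :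
  P \in unitmx -> char_poly (P *m A *m invmx P) = char_poly A.
Proof.
move=> Pu; rewrite /char_poly.
have -> : char_poly_mx (P *m A *m invmx P)
    = map_mx polyC P *m char_poly_mx A *m map_mx polyC (invmx P).
  rewrite /char_poly_mx mulmxBr mulmxBl -!map_mxM mul_mx_scalar -scalemxAl.
  by rewrite -map_mxM mulmxV // map_mx1 scalemx1.
rewrite !det_mulmx mulrC mulrA -det_mulmx -map_mxM mulVmx // map_mx1 det1.
by rewrite mul1r.
Qed.

Lemma is_trig_mx_sqr (R : pzSemiRingType) n (T : 'M[R]_n) i :
  is_trig_mx T -> (T *m T) i i = T i i ^+ 2.
Proof.
move=> /is_trig_mxP Ttrig; rewrite mxE (bigD1 i) //= big1 ?addr0 // => k.
by rewrite neq_ltn => /orP[] lt_ki; rewrite (Ttrig _ _ lt_ki) ?mulr0 ?mul0r.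
Qed.

(** Schur triangularization: conjugation keeps traces and the characteristic polynomial, and the
    diagonal of a triangular matrix lists its eigenvalues with algebraic multiplicity. *)
Lemma sum_eigenvalues n (M : 'M[algC]_n) :
  [/\ size (eigenvalues M) = n,
      \sum_(z <- eigenvalues M) z = \tr M &
      \sum_(z <- eigenvalues M) z ^+ 2 = \tr (M *m M)].
Proof.
case: n M => [|n] M.
  have : size (eigenvalues M) = 0%N.
    apply: succn_inj; rewrite -(size_prod_XsubC _ id) -char_poly_eigenvalues.
    by rewrite size_char_poly.
  by move/size0nil ->; split; rewrite // big_nil /mxtrace big_ord0.
have [P /unitarymx_unit Pu] := Schur M (ltn0Sn n).
rewrite -[is_true _]/(is_true (is_trig_mx (conjmx P M))) conjumx //.
set T := P *m M *m _ => Ttrig.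
have eT : perm_eq (eigenvalues M) [seq T i i | i <- enum 'I_n.+1].
  apply: prod_XsubC_eq; rewrite -char_poly_eigenvalues -(char_poly_conj M Pu).
  by rewrite -/T char_poly_trig // big_map big_enum.
have trC N : \tr (P *m N *m invmx P) = \tr N.
  by rewrite mxtrace_mulC mulmxA mulVmx // mul1mx.
split.
- by rewrite (perm_size eT) size_map size_enum_ord.
- by rewrite (perm_big _ eT) big_map big_enum -(trC M).
have eT2 : P *m (M *m M) *m invmx P = T *m T by rewrite /T !mulmxA mulmxKV.
rewrite (perm_big _ eT) big_map big_enum -(trC (M *m M)) eT2.
by apply: eq_bigr => i _; rewrite is_trig_mx_sqr.
Qed.

Lemma eigenvaluesP n (M : 'M[algC]_n) z :
  z \in eigenvalues M -> exists2 v : 'rV_n, v *m M = z *: v & v != 0.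
Proof.
move=> Mz; apply/eigenvalueP.
by rewrite eigenvalue_root_char char_poly_eigenvalues root_prod_XsubC.
Qed.

(** * Counting in regular graphs *)

Lemma handshake (g : sgraph) : (2 * #|edges g| = \sum_(x : g) degree x)%N.
Proof.
pose f (u : g * g) := [set u.1; u.2]; pose D := [set u : g * g | adj u.1 u.2].
(* Each edge comes from exactly two ordered pairs, since there are no loops. *)
have fiber e : e \in f @: D -> (\sum_(u in D | f u == e) 1 = 2)%N.
  case/imsetP=> -[x y]; rewrite inE /= => xy ->.
  have neq_xy : x != y by apply: contraTneq xy => ->; rewrite adj_irr.
  rewrite sum1dep_card (_ : [set _ | _] = [set (x, y); (y, x)]).
    by rewrite cards2 xpair_eqE (negPf neq_xy).
  apply/setP => -[u v]; rewrite !inE !xpair_eqE /f /=.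
  apply/andP/orP => [[uv /eqP/setP euv]|].
    have neq_uv : u != v by apply: contraTneq uv => ->; rewrite adj_irr.
    move: (euv u) (euv v) neq_uv; rewrite !inE !eqxx orbT /=.
    by move=> /esym/orP[]/eqP-> /esym/orP[]/eqP->; rewrite !eqxx //; auto.
  by case=> /andP[/eqP-> /eqP->]; rewrite ?(adj_sym y) xy // setUC.
have -> : (\sum_(x : g) degree x = \sum_(u in D) 1)%N.
  under eq_bigr => x _ do rewrite /degree -sum1dep_card.
  by rewrite pair_big_dep; apply: eq_bigl => u; rewrite inE.
rewrite (partition_big_imset f) /= (eq_bigr _ fiber) sum_nat_const mulnC.
by congr (_ * _)%N; apply: eq_card => e; rewrite inE.
Qed.

Lemma avg_degree_regular (g : sgraph) d :
  (0 < #|g|)%N -> (forall x : g, degree x = d) -> avg_degree g = d%:R.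
Proof.
move=> g_gt0 deg_g; rewrite /avg_degree handshake.
under eq_bigr => x _ do rewrite deg_g.
by rewrite sum_nat_const mulnC natrM mulfK // pnatr_eq0 -lt0n.
Qed.

(** A vertex adjacent to neither of two adjacent vertices would contradict transitivity, so their
    neighbourhoods cover the graph and inclusion-exclusion applies. Non-adjacent vertices have the
    same neighbourhood. *)
Lemma common_neighbours (g : sgraph) d (x y : g) :
  transitive (fun u v : g => ~~ adj u v) -> (forall z : g, degree z = d) ->
  (#|[set z | adj x z && adj z y]| + (#|g| - d) * adj x y = d)%N.
Proof.
move=> nadj_trans deg_g.
have le_dg : (d <= #|g|)%N by rewrite -(deg_g x) max_card.
have -> : [set z | adj x z && adj z y]
    = [set z | adj x z] :&: [set z | adj y z].
  by apply/setP=> z; rewrite !inE (adj_sym z).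
case: (boolP (adj x y)) => xy.
  have := cardsUI [set z | adj x z] [set z | adj y z].
  have -> : [set z | adj x z] :|: [set z | adj y z] = setT.
    apply/setP=> z; rewrite !inE; apply: contraTT xy => /norP[xz yz].
    by apply: (nadj_trans z); rewrite // adj_sym.
  rewrite cardsT -/(degree x) -/(degree y) !deg_g; lia.
rewrite muln0 addn0 -[RHS](deg_g x); apply: eq_card => z; rewrite !inE.
case: (boolP (adj x z)) => //= xz; apply: contraTT xz => yz.
exact: nadj_trans yz.
Qed.

(** * Spectrum and energies of regular complete multipartite graphs *)

Section AdjacencyMatrix.

Variables (g : sgraph) (d : nat).
Hypothesis nadj_trans : transitive (fun u v : g => ~~ adj u v).
Hypothesis deg_g : forall x : g, degree x = d.

Let A := adjacency_mx g.

Lemma sum_adj_col (y : g) : \sum_(x : g) (adj x y)%:R = d%:R :> algC.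
Proof.
rewrite -natr_sum -(deg_g y) /degree -sum1dep_card.
congr _%:R; rewrite [RHS]big_mkcond.
by apply: eq_bigr => x _; rewrite adj_sym; case: adj.
Qed.

Lemma const_mulmx_adjacency c : const_mx c *m A = const_mx (c * d%:R) :> 'rV_ _.
Proof.
apply/rowP=> j; rewrite !mxE -(sum_adj_col (enum_val j)) mulr_sumr.
rewrite [RHS](reindex _ (onW_bij _ (enum_val_bij g))) /=.
by apply: eq_bigr => k _; rewrite !mxE.
Qed.

Lemma adjacency_mx_sqr :
  A *m A + (#|g|%:R - d%:R) *: A = const_mx d%:R.
Proof.
apply/matrixP=> i j; rewrite !mxE.
have le_dg : (d <= #|g|)%N by rewrite -(deg_g (enum_val i)) max_card.
rewrite -[RHS in _ = RHS](congr1 (fun k => k%:R)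
  (common_neighbours (enum_val i) (enum_val j) nadj_trans deg_g)).
rewrite natrD natrM natrB //; congr (_ + _).
rewrite -sum1dep_card natr_sum [RHS]big_mkcond /=.
rewrite [RHS](reindex _ (onW_bij _ (enum_val_bij g))) /=.
apply: eq_bigr => k _; rewrite !mxE.
by do 2!case: adj; rewrite /= ?mulr1 ?mulr0.
Qed.

Lemma mxtrace_adjacency : \tr A = 0.
Proof. by apply: big1 => i _; rewrite mxE adj_irr. Qed.

Lemma mxtrace_adjacency_sqr : \tr (A *m A) = #|g|%:R * d%:R.
Proof.
have /(canRL (addrK _)) -> := adjacency_mx_sqr.
rewrite linearB linearZ /= mxtrace_adjacency mulr0 subr0.
rewrite /mxtrace; under eq_bigr do rewrite mxE.
by rewrite sumr_const card_ord mulr_natl.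
Qed.

(** By [adjacency_mx_sqr], [(w ^+ 2 + s * w) *: v] is [v] times the constant matrix [d J].
    Multiplying by [A] on the right scales it by [w], as [v] is an eigenvector, and by [d], as
    [J A = d J]. *)
Lemma adjacency_eigenvalue (v : 'rV_#|g|) w :
  v *m A = w *: v -> v != 0 ->
  (w - d%:R) * (w ^+ 2 + (#|g|%:R - d%:R) * w) = 0.
Proof.
move=> vA v_neq0; set s := #|g|%:R - d%:R.
have vJ : (w ^+ 2 + s * w) *: v = v *m const_mx d%:R.
  rewrite -adjacency_mx_sqr mulmxDr mulmxA vA -scalemxAl vA -scalemxAr vA.
  by rewrite !scalerA -scalerDl expr2.
have JA : const_mx d%:R *m A = d%:R *: const_mx d%:R :> 'M_#|g|.
  apply/row_matrixP=> i; rewrite row_mul linearZ /= !row_const.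
  by rewrite const_mulmx_adjacency; apply/rowP=> j; rewrite !mxE.
have := congr1 (mulmx^~ A) vJ.
rewrite /= -mulmxA JA -scalemxAr -vJ -scalemxAl vA.
rewrite !scalerA => /eqP; rewrite -subr_eq0 -scalerBl scaler_eq0 (negPf v_neq0).
by rewrite orbF => /eqP <-; ring.
Qed.

(* On the possible eigenvalues w in {0, d, d - |g|} of A one has             *)
(* |g| |w| = 2 w^2 + (|g| - 2 d) w.                                          *)
Lemma sum_norm_eigenvalues (c e : algC) :
  (0 < #|g|)%N -> e ^+ 2 = 1 ->
  \sum_(z <- eigenvalues (c%:M + e *: A)) `|z - c| = (2 * d)%:R.
Proof.
move=> g_gt0 e2; set M := c%:M + _.
have N0 : #|g|%:R != 0 :> algC by rewrite pnatr_eq0 -lt0n.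
have [x0 _] := card_gt0P g_gt0.
have le_dg : (d <= #|g|)%N by rewrite -(deg_g x0) max_card.
have norm_e : `|e| = 1.
  by apply/eqP; rewrite -[_ == 1](@pexpr_eq1 _ _ 2) // -normrX e2 normr1.
(* The quadratic formula for [|w|] at [w = e * (z - c)], expanded in [z] so that the sum over the
   eigenvalues of [M] only involves the traces of [M] and [M *m M]. *)
have normE z : z \in eigenvalues M ->
    #|g|%:R * `|z - c|
      = 2 * z ^+ 2 + ((#|g|%:R - 2 * d%:R) * e - 4 * c) * z
        + (2 * c ^+ 2 - (#|g|%:R - 2 * d%:R) * e * c).
  case/eigenvaluesP=> v vM v_neq0; set w := e * (z - c).
  have vA : v *m A = w *: v.
    move: vM; rewrite mulmxDr mul_mx_scalar -scalemxAr => /(canRL (addKr _)) vA.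
    rewrite /w -scalerA scalerBl [_ *: v - _]addrC -scaleNr.
    by rewrite scaleNr -vA scalerA -expr2 e2 scale1r.
  have -> : `|z - c| = `|w| by rewrite normrM norm_e mul1r.
  have -> : 2 * z ^+ 2 + ((#|g|%:R - 2 * d%:R) * e - 4 * c) * z
      + (2 * c ^+ 2 - (#|g|%:R - 2 * d%:R) * e * c)
      = 2 * w ^+ 2 + (#|g|%:R - 2 * d%:R) * w.
    by rewrite /w exprMn e2; ring.
  have := adjacency_eigenvalue vA v_neq0; clearbody w.
  have -> : w ^+ 2 + (#|g|%:R - d%:R) * w = w * (w - (d%:R - #|g|%:R)) by ring.
  move/eqP; rewrite !mulf_eq0 !subr_eq0 => /or3P[] /eqP ->.
  - by rewrite normr_nat; ring.
  - by rewrite normr0; ring.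
  by rewrite distrC ger0_norm ?subr_ge0 ?ler_nat //; ring.
have [szM sumM sumM2] := sum_eigenvalues M.
apply: (mulfI N0); rewrite mulr_sumr (eq_big_seq _ normE) big_split big_split /=.
rewrite -!mulr_sumr sumM sumM2 big_const_seq count_predT szM iter_addr addr0.
have -> : M *m M = (c ^+ 2)%:M + ((2 * c * e) *: A + A *m A).
  rewrite /M mulmxDl !mulmxDr -scalar_mxM -expr2 mul_scalar_mx mul_mx_scalar.
  rewrite -scalemxAl -scalemxAr !scalerA -expr2 e2 scale1r addrA -addrA.
  rewrite -!addrA; congr (_ + _); rewrite addrA -scalerDl; congr (_ *: _ + _).
  ring.
(* With [\tr A = 0] and [\tr (A *m A) = N d], all terms in [c] cancel and [2 N d] remains. *)
rewrite /M !mxtraceD !mxtrace_scalar !mxtraceZ mxtrace_adjacency.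
rewrite mxtrace_adjacency_sqr natrM.
ring.
Qed.

Lemma degree_mx_regular : degree_mx g = d%:R%:M.
Proof. by apply/matrixP=> i j; rewrite !mxE deg_g. Qed.

Lemma energies_multipartite :
  (0 < #|g|)%N ->
  [/\ energy g = (2 * d)%:R, laplacian_energy g = (2 * d)%:R
    & signless_laplacian_energy g = (2 * d)%:R].
Proof.
move=> g_gt0; split.
- rewrite -(@sum_norm_eigenvalues 0 1) ?expr1n // scale1r raddf0 add0r.
  by apply: eq_bigr => z _; rewrite subr0.
- rewrite -(@sum_norm_eigenvalues d%:R (-1)) ?sqrrN ?expr1n // scaleN1r.
  rewrite /laplacian_energy /laplacian_mx degree_mx_regular.
  by rewrite (avg_degree_regular g_gt0 deg_g).
rewrite -(@sum_norm_eigenvalues d%:R 1) ?expr1n // scale1r.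
rewrite /signless_laplacian_energy /signless_laplacian_mx degree_mx_regular.
by rewrite (avg_degree_regular g_gt0 deg_g).
Qed.

End AdjacencyMatrix.

(** The complete graph is multipartite with singleton parts: non-adjacency is equality. *)
Lemma energies_complete n :
  (0 < n)%N ->
  [/\ energy (complete_graph n) = (2 * n.-1)%:R,
      laplacian_energy (complete_graph n) = (2 * n.-1)%:R
    & signless_laplacian_energy (complete_graph n) = (2 * n.-1)%:R].
Proof.
move=> n_gt0; apply: energies_multipartite; last by rewrite /= card_ord.
  by move=> y x z /=; rewrite !negbK => /eqP-> /eqP->.
move=> i; rewrite /degree /= -[X in X.-1]card_ord -(cardC1 i).
by apply: eq_card => j; rewrite !inE eq_sym.
Qed.

(** * Groups with abelian centralizers of equal order *)

Section EqualAbelianCentralizers.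

Variables (gT : finGroupType) (G : {group gT}) (k : nat).
Hypothesis cent1_abelian :
  forall x, x \in G :\: 'Z(G)%g -> abelian 'C_G[x]%g.
Hypothesis card_cent1 : forall x, x \in G :\: 'Z(G)%g -> #|'C_G[x]%g| = k.

Let Gamma := noncommuting_graph G.

(** Two elements commuting with [y] both lie in the abelian centralizer of [y]. *)
Lemma noncommuting_nadj_trans :
  transitive (fun x y : Gamma => ~~ adj x y).
Proof.
move=> y x z /=; rewrite /noncommuting !negbK => /eqP xy /eqP yz.
have Gy : val y \in G :\: 'Z(G)%g := valP y.
have [/setDP[Gx _] /setDP[Gz _]] := (valP x, valP z).
apply/eqP; have /centsP := cent1_abelian Gy; apply; rewrite inE ?Gx ?Gz /=.
  exact/cent1P.
exact/cent1P.
Qed.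

(** The neighbours of [x] form the complement of its centralizer: an element not commuting with [x]
    is automatically non-central. *)
Lemma noncommuting_degree (x : Gamma) : degree x = (#|G| - k)%N.
Proof.
have Gx : val x \in G :\: 'Z(G)%g := valP x.
rewrite -(card_cent1 Gx) -(setIidPr (subsetIl G 'C[val x]%g)) -cardsD.
rewrite /degree -(card_imset _ val_inj); apply: eq_card => y.
apply/imsetP/setDP => [[z] | [Gy nCy]].
  rewrite inE /= /noncommuting => xz ->.
  have /setDP[Gz _] : val z \in G :\: 'Z(G)%g := valP z.
  by rewrite inE Gz; split=> //; apply: contraNN xz => /cent1P ->.
have xy : (val x * y != y * val x)%g.
  by apply: contraNN nCy => /eqP xy; rewrite inE Gy; apply/cent1P.
have GZy : y \in G :\: 'Z(G)%g.
  rewrite inE Gy andbT; apply: contraNN xy => /centerP[_ Zy].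
  by rewrite Zy //; case/setDP: Gx.
by exists (Sub y GZy) => //; rewrite inE /= /noncommuting SubK.
Qed.

Lemma noncommuting_energies :
  ~~ abelian G ->
  (energy Gamma = laplacian_energy Gamma /\
   laplacian_energy Gamma = signless_laplacian_energy Gamma) /\
  [/\ ~~ hypoenergetic Gamma, ~~ hyperenergetic Gamma,
      ~~ L_hyperenergetic Gamma & ~~ Q_hyperenergetic Gamma].
Proof.
move=> nabG; have [x Gx] : exists x, x \in G :\: 'Z(G)%g.
  apply/set0Pn; apply: contraNneq nabG => /eqP; rewrite setD_eq0 => sGZ.
  exact: abelianS sGZ (center_abelian G).
have [G_x nZx] := setDP Gx.
have cardN : #|Gamma| = (#|G| - #|'Z(G)%g|)%N.
  have := cardsD G 'Z(G)%g; rewrite (setIidPr (center_sub G)) => <-.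
  by rewrite card_sig; apply: eq_card.
have lt_Zk : (#|'Z(G)%g| < k)%N.
  rewrite -(card_cent1 Gx); apply/proper_card/properP; split.
    by rewrite setIS // -cent_set1 centS // sub1set.
  by exists x; rewrite // inE G_x cent1id.
(* The centralizer of the non-central [x] is a proper subgroup, so its index is at least 2. *)
have le_kG : (2 * k <= #|G|)%N.
  rewrite -(card_cent1 Gx) -(Lagrange (subsetIl G 'C[x]%g)) mulnC leq_mul2l.
  rewrite indexg_gt1 subsetI subxx /= sub_cent1; apply/orP; right.
  by apply: contraNN nZx => cGx; rewrite inE G_x.
have N_gt0 : (0 < #|Gamma|)%N by rewrite cardN; lia.
have [E L Q] := energies_multipartite noncommuting_nadj_trans
  noncommuting_degree N_gt0.
have [EK LK QK] := energies_complete N_gt0.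
rewrite /hypoenergetic /hyperenergetic /L_hyperenergetic /Q_hyperenergetic.
rewrite E L Q EK LK QK !ltr_nat -!leqNgt cardN.
by do 2!split=> //; lia.
Qed.

End EqualAbelianCentralizers.

(** * Centralizers in the Hanaki group *)

Section HanakiCentralizers.

Variable F : finFieldType.
Let H := hanaki_group F.

Lemma hanaki_mx_inj (a b c a' b' c' : F) :
  hanaki_mx a b c = hanaki_mx a' b' c' -> [/\ a = a', b = b' & c = c'].
Proof.
move=> /matrixP eV; split.
- by have := eV 1 0; rewrite !mxE.
- by have := eV 2 0; rewrite !mxE.
by have := eV 2 1; rewrite !mxE.
Qed.

(** The two products can only differ in the lower left entry, by the determinant of the pairs
    [(a, c)] and [(a', c')]. *)
Lemma hanaki_commute (g h : {'GL_3[F]}) a b c a' b' c' :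
  val g = hanaki_mx a b c -> val h = hanaki_mx a' b' c' ->
  (g * h == h * g)%g = (c * a' == c' * a).
Proof.
move=> eg eh; rewrite -val_eqE /= -![_ * _]/(_ *m _) -!/(val _).
rewrite eg eh !hanaki_mxM.
apply/eqP/eqP => [/hanaki_mx_inj[_ + _] | ->].
  by rewrite [b' + b]addrC => /addrI.
by rewrite (addrC a) (addrC b) (addrC c).
Qed.

Lemma hanaki_noncentral (g : {'GL_3[F]}) a b c :
  g \in H :\: 'Z(H)%g -> val g = hanaki_mx a b c -> (a != 0) || (c != 0).
Proof.
case/setDP=> Hg nZg eg; apply: contraNT nZg.
rewrite negb_or !negbK => /andP[/eqP a0 /eqP c0].
apply/centerP; split=> // h /hanaki_setP[a' [b' [c' eh]]].
by apply/eqP; rewrite (hanaki_commute eg eh) a0 c0 mul0r mulr0.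
Qed.

Lemma hanaki_collinear (a c a' c' : F) :
  (a != 0) || (c != 0) -> c * a' = c' * a ->
  exists t, a' = t * a /\ c' = t * c.
Proof.
case: (eqVneq a 0) => [-> /= c0 | a0 _] e.
  exists (c' / c); rewrite mulr0 divfK //; split=> //.
  by move/eqP: e; rewrite mulr0 mulf_eq0 (negPf c0) => /eqP.
by exists (a' / a); rewrite divfK // mulrAC [a' * c]mulrC e mulfK.
Qed.

Lemma hanaki_cent1_abelian g : g \in H :\: 'Z(H)%g -> abelian 'C_H[g]%g.
Proof.
move=> Hg; have /setDP[/hanaki_setP[a [b [c eg]]] _] := Hg.
have ac0 := hanaki_noncentral Hg eg.
have param h : h \in 'C_H[g]%g ->
    exists t b', val h = hanaki_mx (t * a) b' (t * c).
  case/setIP=> /hanaki_setP[a' [b' [c' eh]]] /cent1P/esym/eqP.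
  rewrite (hanaki_commute eg eh) => /eqP /(hanaki_collinear ac0)[t [ea ec]].
  by exists t, b'; rewrite eh ea ec.
apply/centsP => h /param[t [b1 eh]] h' /param[t' [b2 eh']].
by apply/eqP; rewrite (hanaki_commute eh eh'); apply/eqP; ring.
Qed.

Lemma card_hanaki_cent1 g : g \in H :\: 'Z(H)%g -> #|'C_H[g]%g| = (#|F| ^ 2)%N.
Proof.
move=> Hg; have /setDP[/hanaki_setP[a [b [c eg]]] _] := Hg.
have ac0 := hanaki_noncentral Hg eg.
(* The centralizer consists of the matrices whose outer parameters are a multiple of the nonzero
   pair [(a, c)], with a free middle one. So [F * F] parametrizes it bijectively. *)
pose V (u : F * F) := hanaki_mx (u.1 * a) u.2 (u.1 * c).
have V_inj : injective V.
  move=> [t x] [t' x'] /hanaki_mx_inj[/= ea -> ec]; congr (_, _).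
  by case/orP: ac0 => nz; apply: (mulIf nz).
rewrite -(card_imset _ val_inj) -mulnn -card_prod -(card_imset _ V_inj).
apply: eq_card => M; apply/imsetP/imsetP => [[h] | [[t x] _ ->]].
  case/setIP=> /hanaki_setP[a' [b' [c' eh]]] /cent1P/esym/eqP.
  rewrite (hanaki_commute eg eh) => /eqP /(hanaki_collinear ac0)[t [ea ec]] ->.
  by exists (t, b'); rewrite // eh ea ec.
have [h Hh eh] := hanaki_mx_in (t * a) x (t * c).
exists h => //; rewrite inE Hh; apply/cent1P/esym/eqP.
by rewrite (hanaki_commute eg eh) mulrCA mulrA.
Qed.

Lemma hanaki_nonabelian : ~~ abelian H.
Proof.
have [g Hg eg] := hanaki_mx_in (1 : F) 0 0.
have [h Hh eh] := hanaki_mx_in (0 : F) 0 1.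
apply: contraT => /negPn/centsP/(_ g Hg h Hh)/eqP.
by rewrite (hanaki_commute eg eh) mulr0 mulr1 eq_sym oner_eq0.
Qed.

End HanakiCentralizers.

Theorem theorem5p6 (p n : nat) (F : finFieldType) (gT : finGroupType)
    (G : {group gT}) :
  prime p -> (0 < n)%N -> #|F| = (p ^ n)%N -> (G \isog hanaki_group F)%g ->
  let Gamma := noncommuting_graph G in
  (energy Gamma = laplacian_energy Gamma /\
   laplacian_energy Gamma = signless_laplacian_energy Gamma) /\
  [/\ ~~ hypoenergetic Gamma, ~~ hyperenergetic Gamma,
      ~~ L_hyperenergetic Gamma & ~~ Q_hyperenergetic Gamma].
Proof.
move=> _ _ _ isoGH Gamma.
have /isogP[f injf fG] := isoGH.
(* The isomorphism carries non-central elements and their centralizers to those of the Hanaki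
   group. *)
have noncentral_f x : x \in G :\: 'Z(G)%g ->
    f x \in hanaki_group F :\: 'Z(hanaki_group F)%g.
  case/setDP=> Gx nZx; rewrite -fG -injm_center //.
  apply/setDP; split; first exact: mem_morphim.
  by apply: contraNN nZx => /morphimP[z Gz Zz /(injmP injf)->].
have cent1_f x : x \in G -> (f @* 'C_G[x] = 'C_(hanaki_group F)[f x])%g.
  by move=> Gx; rewrite morphimIdom injm_cent1 // fG.
apply: (@noncommuting_energies _ _ (#|F| ^ 2)%N).
- move=> x Gx; have /setDP[G_x _] := Gx.
  rewrite -(injm_abelian injf) ?subsetIl // cent1_f //.
  exact/hanaki_cent1_abelian/noncentral_f.
- move=> x Gx; have /setDP[G_x _] := Gx.
  rewrite -(card_injm injf) ?subsetIl // cent1_f //.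
  exact/card_hanaki_cent1/noncentral_f.
by rewrite (isog_abelian isoGH) hanaki_nonabelian.
Qed.
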